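(* Suppose the data assumption stated in the context holds. Set $\mathcal{S}_{max}=\llbracket1,r_{max}\rrbracket$ and $Q_{max}=\llbracket1,d_y\rrbracket\setminus\mathcal{S}_{max}=\llbracket r_{max}+1,d_y\rrbracket$. Then $\mathbf{W}=(W_H,\dots,W_1)$ is a global minimizer of $L$ if and only if there exist invertible matrices $D_{H-1}\in\mathbb{R}^{d_{H-1}\times d_{H-1}},\dots,D_1\in\mathbb{R}^{d_1\times d_1}$ and matrices $Z_H\in\mathbb{R}^{(d_y-r_{max})\times(d_{H-1}-r_{max})}$, $Z_h\in\mathbb{R}^{(d_h-r_{max})\times(d_{h-1}-r_{max})}$ for $h\in\llbracket2,H-1\rrbracket$, and $Z_1\in\mathbb{R}^{(d_1-r_{max})\times d_x}$ such that $$W_H=[U_{\mathcal{S}_{max}},\,U_{Q_{max}}Z_H]D_{H-1}^{-1},\qquad W_1=D_1\begin{bmatrix}U_{\mathcal{S}_{max}}^T\Sigma_{YX}\Sigma_{XX}^{-1}\\ Z_1\end{bmatrix},$$ $$W_h=D_h\begin{bmatrix}I_{r_{max}}&0\\0&Z_h\end{bmatrix}D_{h-1}^{-1}\qquad\forall h\in\llbracket2,H-1\rrbracket.$$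
   Context: Setting. Let $H\ge 2$ and let $d_0,\dots,d_H,m$ be positive integers; write $d_x=d_0$, $d_y=d_H$, $r_{max}=\min(d_H,\dots,d_0)$. Parameters are $\mathbf{W}=(W_H,\dots,W_1)$ with $W_h\in\mathbb{R}^{d_h\times d_{h-1}}$. Given data $X\in\mathbb{R}^{d_x\times m}$, $Y\in\mathbb{R}^{d_y\times m}$, the loss is $L(\mathbf{W})=\|W_H\cdots W_1X-Y\|^2$ (Frobenius norm). Set $\Sigma_{XX}=XX^T$, $\Sigma_{XY}=XY^T$, $\Sigma_{YX}=YX^T$. Data assumption. $d_y\le d_x\le m$, $\Sigma_{XX}$ is invertible, $\Sigma_{XY}$ has full rank $d_y$, and, with $\Sigma^{1/2}=\Sigma_{YX}\Sigma_{XX}^{-1}X\in\mathbb{R}^{d_y\times m}$ and $\Sigma=\Sigma^{1/2}(\Sigma^{1/2})^T=\Sigma_{YX}\Sigma_{XX}^{-1}\Sigma_{XY}$, the singular values of $\Sigma^{1/2}$ are all distinct (i.e. $\Sigma$ has $d_y$ distinct eigenvalues). Let $\Sigma^{1/2}=U\Delta V^T$ be a singular value decomposition with $U\in\mathbb{R}^{d_y\times d_y}$, $V\in\mathbb{R}^{m\times m}$ orthogonal and the diagonal entries of $\Delta\in\mathbb{R}^{d_y\times m}$ in decreasing order. Notation. $\llbracket a,b\rrbracket$ is the set of integers from $a$ to $b$ (empty if $a>b$). $A_{\mathcal{J}}$ is the submatrix of $A$ formed by the columns indexed by $\mathcal{J}$. $[A,B]$ is horizontal concatenation. Blocks may have 0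 rows or 0 columns (then they are absent); a product of a matrix with 0 columns and a matrix with 0 rows is the zero matrix of the appropriate size. For instance, if $r_{max}=d_y$ then $U_{Q_{max}}Z_H=0_{d_y\times(d_{H-1}-r_{max})}$. *)

(* Defs.v *)
From mathcomp Require Import all_boot all_order all_algebra.
From mathcomp Require Import reals.

Set Implicit Arguments.
Unset Strict Implicit.
Unset Printing Implicit Defensive.

Import Order.TTheory GRing.Theory Num.Theory.
Local Open Scope ring_scope.

Definition frob_sq (R : realType) (p q : nat) (A : 'M[R]_(p, q)) : R :=
  \sum_i \sum_j A i j ^+ 2.

(* A network of depth [H] with widths [d 0, ..., d H] is a family [W] indexed
   by [nat] in which only [W 1, ..., W H] are used; [W h] has [d h] rows and
   [d (h - 1)] columns.  The values of [d] beyond [H], and of [W] outside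
   [1, ..., H], never enter the loss. *)
Definition params (R : realType) (d : nat -> nat) : Type :=
  forall h : nat, 'M[R]_(d h, d h.-1).

(* [netprod W k] is W_k *m ... *m W_1. *)
Fixpoint netprod (R : realType) (d : nat -> nat) (W : params R d) (k : nat) :
    'M[R]_(d k, d 0%N) :=
  match k with
  | 0%N => 1%:M
  | k'.+1 => W k'.+1 *m netprod W k'
  end.

Definition loss (R : realType) (d : nat -> nat) (H m : nat)
    (X : 'M[R]_(d 0%N, m)) (Y : 'M[R]_(d H, m)) (W : params R d) : R :=
  frob_sq (netprod W H *m X - Y).

Definition global_minimizer (R : realType) (d : nat -> nat) (H m : nat)
    (X : 'M[R]_(d 0%N, m)) (Y : 'M[R]_(d H, m)) (W : params R d) : Prop :=
  forall W' : params R d, loss X Y W <= loss X Y W'.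

Section Data.
Variables (R : realType) (dx dy m : nat).
Variables (X : 'M[R]_(dx, m)) (Y : 'M[R]_(dy, m)).

Definition SigmaXX : 'M[R]_dx := X *m X^T.
Definition SigmaXY : 'M[R]_(dx, dy) := X *m Y^T.
Definition SigmaYX : 'M[R]_(dy, dx) := Y *m X^T.
Definition SigmaHalf : 'M[R]_(dy, m) := SigmaYX *m invmx SigmaXX *m X.
Definition Sigma : 'M[R]_dy := SigmaHalf *m SigmaHalf^T.

(* The singular values of [SigmaHalf] are the square roots of the [dy]
   eigenvalues of [Sigma]; they are all distinct when [Sigma] has [dy] distinct
   eigenvalues. *)
Record data_assumption : Prop := DataAssumption {
  data_dy_dx : (dy <= dx)%N;
  data_dx_m : (dx <= m)%N;
  data_XX_inv : SigmaXX \in unitmx;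
  data_XY_rank : \rank SigmaXY = dy;
  data_distinct : exists s : seq R,
    [/\ uniq s, size s = dy & all (eigenvalue Sigma) s]
}.

End Data.

Definition orthogonal_mx (R : realType) (n : nat) (A : 'M[R]_n) : Prop :=
  A^T *m A = 1%:M.

Record is_svd (R : realType) (p q : nat) (A : 'M[R]_(p, q))
    (U : 'M[R]_p) (Delta : 'M[R]_(p, q)) (V : 'M[R]_q) : Prop := IsSvd {
  svd_U : orthogonal_mx U;
  svd_V : orthogonal_mx V;
  svd_diag : is_diag_mx Delta;
  svd_ge0 : forall (i : 'I_p) (j : 'I_q), i = j :> nat -> 0 <= Delta i j;
  svd_decr : forall (i i' : 'I_p) (j j' : 'I_q),
    i = j :> nat -> i' = j' :> nat -> (i <= i')%N -> Delta i' j' <= Delta i j;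
  svd_eq : A = U *m Delta *m V^T
}.

Definition rmax (d : nat -> nat) (H : nat) : nat :=
  \big[minn/d 0%N]_(1 <= h < H.+1) d h.

Lemma rmax_le (d : nat -> nat) (H h : nat) : (h <= H)%N -> (rmax d H <= d h)%N.
Proof.
rewrite /rmax; elim: H h => [|H IH] h.
  by rewrite leqn0 => /eqP ->; rewrite big_geq.
have minE n : \big[minn/d 0%N]_(1 <= k < n.+2) d k =
    minn (\big[minn/d 0%N]_(1 <= k < n.+1) d k) (d n.+1).
  have key s x : foldr minn (d 0%N) (rcons s x) = minn (foldr minn (d 0%N) s) x.
    by elim: s => [|y s /= ->]; rewrite /= ?minnA // minnC.
  have bigE (s : seq nat) :
      \big[minn/d 0%N]_(k <- s) d k = foldr minn (d 0%N) (map d s).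
    by elim: s => [|x s IHs]; rewrite ?big_nil // big_cons IHs.
  rewrite !bigE /index_iota !subSS !subn0 -{1}[n.+1]addn1 iotaD map_cat /=.
  by rewrite cats1 key add1n.
rewrite minE leq_eqVlt => /orP[/eqP -> | lthH]; first exact: geq_minr.
by apply: leq_trans (geq_minl _ _) (IH _ _).
Qed.

Lemma rmax_le_pred (d : nat -> nat) (H h : nat) :
  (h <= H)%N -> (rmax d H <= d h.-1)%N.
Proof. by move=> hH; apply: rmax_le; apply: leq_trans (leq_pred h) hH. Qed.

(* In what follows a dimension [n >= r] is split as [r + (n - r)], and the casts
   only identify [r + (n - r)] with [n].  The 1-based index sets
   {1, ..., r} and {r + 1, ..., n} are the 0-based {i < r} and {r <= i < n}. *)
Section Blocks.
Variables (R : realType) (r : nat).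

Definition first_cols (p n : nat) (hn : (r <= n)%N) (A : 'M[R]_(p, n)) :
    'M[R]_(p, r) :=
  colsub (widen_ord hn) A.

Definition last_cols (p n : nat) (hn : (r <= n)%N) (A : 'M[R]_(p, n)) :
    'M[R]_(p, n - r) :=
  colsub (fun j : 'I_(n - r) => cast_ord (subnKC hn) (rshift r j)) A.

Definition hcat (p n : nat) (hn : (r <= n)%N)
    (A : 'M[R]_(p, r)) (B : 'M[R]_(p, n - r)) : 'M[R]_(p, n) :=
  castmx (erefl p, subnKC hn) (row_mx A B).

Definition vcat (n q : nat) (hn : (r <= n)%N)
    (A : 'M[R]_(r, q)) (B : 'M[R]_(n - r, q)) : 'M[R]_(n, q) :=
  castmx (subnKC hn, erefl q) (col_mx A B).

Definition id_block (n q : nat) (hn : (r <= n)%N) (hq : (r <= q)%N)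
    (Z : 'M[R]_(n - r, q - r)) : 'M[R]_(n, q) :=
  castmx (subnKC hn, subnKC hq) (block_mx 1%:M 0 0 Z).

End Blocks.

(* Main.v *)
Require Import Defs.
From mathcomp Require Import all_boot all_order all_algebra.
From mathcomp Require Import reals.
From mathcomp Require Import ring lra.

Set Implicit Arguments.
Unset Strict Implicit.
Unset Printing Implicit Defensive.

Import Order.TTheory GRing.Theory Num.Theory.
Local Open Scope ring_scope.

(** Write [S] for [SigmaHalf X Y], the projection of [Y] on the row space of [X],
    and [P = W_H ... W_1].  The loss splits as [|P X - S|^2 + |S - Y|^2]
    ([frob_sq_regression]), so only the first term matters, and [P X] ranges over
    matrices of rank at most [r = rmax d H], the smallest width.

    By Eckart-Young ([eckart_young]), the unique best approximation of [S] of
    rank at most [r] is [U_S U_S^T S]: it is unique because the singular values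
    are positive and strictly decreasing ([gram_diag_gt0], [svd_strict]).  As [X]
    has full row rank and the value [P = U_S N], with
    [N = U_S^T SigmaYX SigmaXX^-1], is reached by some network, [W] is a global
    minimizer if and only if [W_H ... W_1 = U_S N] ([netprod_best]).

    It remains to describe the factorizations of [U_S N].  A network in the
    stated form has product [U_S N + U_Q Z_H ... Z_1], and the second term
    vanishes because one of the blocks [Z_h] has no row or no column
    ([netprod_normal]); when the narrowest layer is the input, this uses
    [d_y <= d_x].  Conversely, in any factorization the partial products
    [C_h = W_h ... W_1 N'], with [N'] a right inverse of [N], and
    [K_h = U_S^T W_H ... W_(h+1)] satisfy [K_h C_h = 1].  Each hidden space is
    thus the direct sum of the columns of [C_h] and of the kernel of [K_h], the
    layers respect these decompositions, and bases adapted to them are the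
    matrices [D_h] ([adapted_frame], [normal_of_netprod]). *)

(** * Frobenius norm and orthogonal projectors *)

Lemma frob_sqE (R : realType) (p q : nat) (A : 'M[R]_(p, q)) :
  frob_sq A = \tr (A *m A^T).
Proof.
rewrite /frob_sq /mxtrace; apply: eq_bigr => i _; rewrite mxE.
by apply: eq_bigr => j _; rewrite mxE expr2.
Qed.

Lemma frob_sq_ge0 (R : realType) (p q : nat) (A : 'M[R]_(p, q)) :
  0 <= frob_sq A.
Proof. by do 2!apply: sumr_ge0 => ? _; exact: sqr_ge0. Qed.

Lemma frob_sq0 (R : realType) (p q : nat) : frob_sq (0 : 'M[R]_(p, q)) = 0.
Proof. by rewrite frob_sqE mul0mx mxtrace0. Qed.

Lemma frob_sq_eq0 (R : realType) (p q : nat) (A : 'M[R]_(p, q)) :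
  frob_sq A = 0 -> A = 0.
Proof.
move=> A0; apply/matrixP => i j; rewrite [RHS]mxE; apply/eqP.
rewrite -sqrf_eq0; apply/eqP.
have ge0 k l : 0 <= A k l ^+ 2 by exact: sqr_ge0.
have row_ge0 k : 0 <= \sum_j A k j ^+ 2 by exact: sumr_ge0.
have row0 := psumr_eq0P (fun k _ => row_ge0 k) A0.
exact: (psumr_eq0P (fun l _ => ge0 i l) (row0 i isT)).
Qed.

Lemma gram_eq0 (R : realType) (p q : nat) (A : 'M[R]_(p, q)) :
  A *m A^T = 0 -> A = 0.
Proof. by move=> A0; apply: frob_sq_eq0; rewrite frob_sqE A0 mxtrace0. Qed.

Lemma gram_unit (R : realType) (p q : nat) (A : 'M[R]_(p, q)) :
  row_free A -> A *m A^T \in unitmx.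
Proof.
rewrite -row_free_unit -!kermx_eq0 => /eqP kA0; apply/eqP.
set K := kermx _.
have KA0 : K *m A = 0.
  apply: gram_eq0; rewrite trmx_mul mulmxA -(mulmxA K).
  by rewrite mulmx_ker mul0mx.
by apply/eqP; rewrite -submx0 -kA0; apply/sub_kermxP.
Qed.

Lemma frob_sq_pythagoras (R : realType) (p q : nat) (A B : 'M[R]_(p, q)) :
  \tr (A *m B^T) = 0 -> frob_sq (A + B) = frob_sq A + frob_sq B.
Proof.
move=> AB0; rewrite !frob_sqE linearD /= mulmxDl !mulmxDr !mxtraceD.
have -> : \tr (B *m A^T) = \tr (A *m B^T).
  by rewrite -mxtrace_tr trmx_mul trmxK.
by rewrite AB0 addr0 add0r.
Qed.

(** With [C] a column basis of [B], the projector is [C (C^T C)^-1 C^T]; its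
    trace is that of the identity on the [\rank B] columns of [C]. *)
Lemma col_projector (R : realType) (p q : nat) (B : 'M[R]_(p, q)) :
  exists Q : 'M[R]_p,
    [/\ Q^T = Q, Q *m Q = Q, Q *m B = B & \tr Q = (\rank B)%:R].
Proof.
move: (col_base B) (row_base B) (col_base_full B) (mulmx_base B).
move=> C N fC CN; have uG : C^T *m C \in unitmx.
  rewrite -{2}[C]trmxK; apply: gram_unit.
  by rewrite -[row_free _]/(\rank C^T == _) mxrank_tr.
have GT : (C^T *m C)^T = C^T *m C by rewrite trmx_mul trmxK.
exists (C *m invmx (C^T *m C) *m C^T); split.
- by rewrite trmx_mul trmxK trmx_mul trmx_inv GT mulmxA.
- by rewrite -!mulmxA (mulmxA C^T C) (mulmxA (invmx _) (C^T *m C)) mulVmx ?mul1mx.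
- by rewrite -[X in _ *m X = _]CN -!mulmxA (mulmxA C^T C) mulKmx.
- by rewrite -mulmxA mxtrace_mulC -mulmxA mulVmx // mxtrace1.
Qed.

(** [B - QS] has its columns in the range of [Q], [S - QS] in the orthogonal of
    that range. *)
Lemma frob_sq_projector (R : realType) (p q : nat) (S B : 'M[R]_(p, q))
    (Q : 'M[R]_p) :
  Q^T = Q -> Q *m Q = Q -> Q *m B = B ->
  frob_sq (B - S) =
  frob_sq (B - Q *m S) + (\tr (S *m S^T) - \tr (Q *m (S *m S^T))).
Proof.
move=> QT QQ QB.
have NT : (Q - 1%:M)^T = Q - 1%:M by rewrite linearB /= QT trmx1.
have QN : Q *m (Q - 1%:M) = 0 by rewrite mulmxBr QQ mulmx1 subrr.
have -> : B - S = (B - Q *m S) + (Q - 1%:M) *m S.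
  by rewrite mulmxBl mul1mx addrA subrK.
rewrite frob_sq_pythagoras.
  congr (_ + _); rewrite frob_sqE trmx_mul NT -mulmxA mxtrace_mulC -!mulmxA.
  rewrite (mulmxBl Q) QN mul1mx sub0r opprB mulmxA mulmxBr mulmx1 linearB /=.
  by rewrite (mxtrace_mulC _ Q).
rewrite -{1}QB -mulmxBr trmx_mul NT -mulmxA mxtrace_mulC -!mulmxA.
have -> : (Q - 1%:M) *m Q = 0 by apply: trmx_inj; rewrite trmx_mul NT QT QN trmx0.
by rewrite !mulmx0 mxtrace0.
Qed.

(** * Best approximation of bounded rank *)

Lemma projector_diag (R : realType) (p : nat) (q : 'M[R]_p) (i : 'I_p) :
  q^T = q -> q *m q = q -> q i i = \sum_j q i j ^+ 2.
Proof.
move=> qT qq; rewrite -{1}qq mxE; apply: eq_bigr => j _.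
by rewrite expr2 -{2}qT mxE.
Qed.

(** A projector with [0]-[1] diagonal is diagonal: a diagonal entry is the sum
    of the squares of its row, so that the other entries of the row vanish. *)
Lemma projector_pid (R : realType) (p r : nat) (q : 'M[R]_p) :
  q^T = q -> q *m q = q -> (forall i, q i i = (i < r)%:R) -> q = pid_mx r.
Proof.
move=> qT qq qD; apply/matrixP => i j; rewrite [RHS]mxE.
have [<- | ij] := eqVneq i j; first by rewrite eqxx qD.
rewrite (negPf (ij : i != j :> nat)) /=.
have := projector_diag i qT qq; rewrite (bigD1 i) //= (qD i).
have -> : ((i < r)%N%:R : R) ^+ 2 = (i < r)%N%:R.
  by case: (i < r)%N; rewrite ?expr1n ?expr0n.
rewrite -{1}[X in X = _]addr0 => /addrI/esym s0.
have sge k : k != i -> 0 <= q i k ^+ 2 by move=> _; exact: sqr_ge0.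
apply/eqP; rewrite -sqrf_eq0; apply/eqP.
by apply: (psumr_eq0P sge s0); rewrite eq_sym.
Qed.

Lemma trace_mul_diag (R : realType) (p : nat) (A : 'M[R]_p) (d : 'rV[R]_p) :
  \tr (A *m diag_mx d) = \sum_i A i i * d 0 i.
Proof. by rewrite mul_mx_diag; apply: eq_bigr => i _; rewrite mxE. Qed.

(** Eckart-Young with uniqueness.  By the identity [frob_sq_projector], the
    distance from [S] to matrices with range in that of a projector [Q] is
    governed by [\tr (Q S S^T)], which in the eigenbasis [U] is the sum of
    [lam_i q_i], where the weights [q_i] lie in [0, 1] and have sum at most [r].
    As [mu] separates the [r] largest eigenvalues from the others, this sum is
    largest exactly when the weights are the indicator of [i < r]. *)
Lemma eckart_young (R : realType) (p q r : nat) (U : 'M[R]_p)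
    (S B : 'M[R]_(p, q)) (lam : 'rV[R]_p) (mu : R) :
  U^T *m U = 1%:M -> S *m S^T = U *m diag_mx lam *m U^T ->
  (r <= p)%N -> 0 <= mu ->
  (forall i : 'I_p, (i < r)%N -> mu < lam 0 i) ->
  (forall i : 'I_p, (r <= i)%N -> lam 0 i < mu) ->
  (\rank B <= r)%N ->
  let T := U *m pid_mx r *m U^T *m S in
  frob_sq (T - S) <= frob_sq (B - S) /\
  (frob_sq (B - S) <= frob_sq (T - S) -> B = T).
Proof.
move=> UU SS rp mu0 lam_hi lam_lo rB T.
have UU' : U *m U^T = 1%:M by exact: mulmx1C.
have [Q [QT QQ QB trQ]] := col_projector B.
pose QS := U *m (pid_mx r : 'M_p) *m U^T.
have QST : QS^T = QS by rewrite /QS !trmx_mul trmxK tr_pid_mx mulmxA.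
have QSQS : QS *m QS = QS.
  by rewrite /QS -!mulmxA (mulmxA U^T U) UU mul1mx (mulmxA (pid_mx r)) pid_mx_id.
have trE A : \tr (A *m (S *m S^T)) = \sum_i (U^T *m A *m U) i i * lam 0 i.
  by rewrite -trace_mul_diag SS mulmxA mxtrace_mulC !mulmxA.
have dT : frob_sq (T - S) = \tr (S *m S^T) - \sum_(i < p) (i < r)%:R * lam 0 i.
  have QS_T : QS *m T = T by rewrite [LHS](mulmxA QS QS S) QSQS.
  rewrite (frob_sq_projector S QST QSQS QS_T) subrr frob_sq0 add0r.
  congr (_ - _); rewrite trE; apply: eq_bigr => i _; congr (_ * _).
  by rewrite /QS !mulmxA UU mul1mx -mulmxA UU mulmx1 mxE eqxx.
pose w := U^T *m Q *m U.
have wT : w^T = w by rewrite /w !trmx_mul trmxK QT mulmxA.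
have ww : w *m w = w.
  by rewrite /w -!mulmxA (mulmxA U U^T) UU' mul1mx (mulmxA Q Q) QQ.
have wD i := projector_diag i wT ww.
have w_ge0 i : 0 <= w i i by rewrite wD; apply: sumr_ge0 => j _; exact: sqr_ge0.
have w_le1 i : w i i <= 1.
  have : w i i ^+ 2 <= w i i.
    rewrite {2}wD (bigD1 i) //= lerDl.
    by apply: sumr_ge0 => j _; exact: sqr_ge0.
  rewrite expr2; have := w_ge0 i; nra.
have trw : \sum_i w i i = (\rank B)%:R.
  by rewrite -trQ -[LHS]/(\tr w) /w mxtrace_mulC mulmxA UU' mul1mx.
have dB := @frob_sq_projector R p q S B Q QT QQ QB.
rewrite trE -/w in dB.
pose g i := (lam 0 i - mu) * ((i < r)%:R - w i i).
have g_ge0 i : 0 <= g i.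
  rewrite /g; case: ltnP => ir.
    by apply: mulr_ge0; rewrite subr_ge0 // ltW // lam_hi.
  by apply: mulr_le0; rewrite ?sub0r ?oppr_le0 // subr_le0 ltW // lam_lo.
have sum_e : \sum_(i < p) ((i < r)%:R : R) = r%:R.
  transitivity (\sum_(i < p | (i < r)%N) (1 : R)).
    by rewrite [RHS]big_mkcond; apply: eq_bigr => i _; case: ltnP.
  by rewrite -(big_ord_widen p (fun=> 1)) // sumr_const card_ord.
(* Shifting the eigenvalues by [mu] makes every term of the excess nonnegative;
   the last summand accounts for a rank smaller than [r]. *)
have gap : \sum_(i < p) (i < r)%:R * lam 0 i - \sum_i w i i * lam 0 i =
    \sum_i g i + mu * (r%:R - (\rank B)%:R).
  rewrite -sum_e -trw -!sumrB mulr_sumr -big_split /=.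
  by apply: eq_bigr => i _; rewrite /g; ring.
have sg_ge0 : 0 <= \sum_i g i by exact: sumr_ge0.
have rk_ge0 : 0 <= mu * (r%:R - (\rank B)%:R).
  by rewrite mulr_ge0 // subr_ge0 ler_nat.
have := frob_sq_ge0 (B - Q *m S) => dB0; split; first by lra.
move=> le_BT.
have sg0 : \sum_i g i = 0 by lra.
have BQ : B = Q *m S.
  by apply/eqP; rewrite -subr_eq0; apply/eqP/frob_sq_eq0; lra.
have w_pid : w = pid_mx r.
  apply: projector_pid => // i.
  have /eqP : g i = 0 by exact: (psumr_eq0P (fun i _ => g_ge0 i) sg0).
  rewrite /g mulf_eq0 !subr_eq0 => /orP[/eqP lam_mu|/eqP ->//].
  have [ir|ir] := ltnP i r; [have := lam_hi i ir|have := lam_lo i ir];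
  by rewrite lam_mu ltxx.
rewrite BQ /T -w_pid /w !mulmxA UU' mul1mx -(mulmxA Q) UU' mulmx1 //.
Qed.

(** * Block decompositions as sums over selectors *)

(** Together with the selector [pid_mx r] of the first [r] coordinates, it turns
    block matrices into plain sums of products, without any cast between
    [r + (n - r)] and [n]. *)
Definition bot_mx (R : realType) (r n : nat) : 'M[R]_(n - r, n) :=
  \matrix_(i, j) (j == (r + i)%N :> nat)%:R.

Section Selectors.
Variables (R : realType) (r n : nat).
Hypothesis hn : (r <= n)%N.
Local Notation top := (pid_mx r : 'M[R]_(r, n)).
Local Notation bot := (bot_mx R r n).

Lemma hcatE p (A : 'M[R]_(p, r)) (B : 'M[R]_(p, n - r)) :
  hcat hn A B = A *m top + B *m bot.
Proof.
have castE k (e : (r + k = n)%N) (C : 'M[R]_(p, k)) :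
    castmx (erefl p, e) (row_mx A C) =
    A *m top + C *m (\matrix_(i, j) (j == (r + i)%N :> nat)%:R).
  case: n / e => /=; rewrite castmx_id pid_mx_row.
  have -> : \matrix_(i < k, j < r + k) (j == (r + i)%N :> nat)%:R =
      row_mx 0 1%:M :> 'M[R]_(k, r + k).
    apply/matrixP => i j; rewrite !mxE; case: splitP => l ->; rewrite mxE.
      by rewrite ltn_eqF // ltn_addr.
    by rewrite eqn_add2l eq_sym.
  by rewrite !mul_mx_row !mulmx0 !mulmx1 add_row_mx addr0 add0r.
exact: castE.
Qed.

Lemma top_topT : top *m top^T = 1%:M.
Proof. by rewrite tr_pid_mx pid_mx_id // pid_mx_1. Qed.

Lemma bot_botT : bot *m bot^T = 1%:M.
Proof.
apply/matrixP => i j; rewrite !mxE.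
have lt_n : (r + i < n)%N by rewrite -{2}(subnKC hn) ltn_add2l.
rewrite (bigD1 (Ordinal lt_n)) //= !mxE eqxx mul1r eqn_add2l big1 ?addr0 //.
by move=> k ki; rewrite !mxE (negPf (ki : k != (r + i)%N :> nat)) mul0r.
Qed.

Lemma top_botT : top *m bot^T = 0.
Proof.
apply/matrixP => i j; rewrite !mxE big1 // => k _; rewrite !mxE.
case: eqP => [<- | _]; last by rewrite mul0r.
by rewrite ltn_eqF ?mulr0 // ltn_addr.
Qed.

Lemma bot_topT : bot *m top^T = 0.
Proof. by apply: trmx_inj; rewrite trmx_mul trmxK top_botT trmx0. Qed.

Lemma topT_top : top^T *m top = pid_mx r.
Proof. by rewrite tr_pid_mx pid_mx_id. Qed.

Lemma topT_botT_sum : top^T *m top + bot^T *m bot = 1%:M.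
Proof.
rewrite tr_pid_mx pid_mx_id //; apply/matrixP => i j; rewrite !mxE.
have [ir | ri] := ltnP i r.
  rewrite andbT big1 ?addr0 // => k _; rewrite !mxE.
  by rewrite ltn_eqF ?mul0r // ltn_addr.
have lt_nr : (i - r < n - r)%N by rewrite ltn_sub2r // (leq_ltn_trans ri).
rewrite andbF add0r (bigD1 (Ordinal lt_nr)) //= !mxE /= subnKC // eqxx mul1r.
rewrite big1 ?addr0 1?eq_sym // => k ki; rewrite !mxE.
case: eqP => [ik | _]; last by rewrite mul0r.
by case/eqP: ki; apply: val_inj; rewrite /= ik addKn.
Qed.

Lemma vcatE q (A : 'M[R]_(r, q)) (B : 'M[R]_(n - r, q)) :
  vcat hn A B = top^T *m A + bot^T *m B.
Proof.
apply: trmx_inj; rewrite linearD /= !trmx_mul !trmxK -hcatE.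
by rewrite /vcat /hcat trmx_cast tr_col_mx.
Qed.

Lemma first_colsE p (A : 'M[R]_(p, n)) : first_cols hn A = A *m top^T.
Proof.
apply/matrixP => i j; rewrite !mxE (bigD1 (widen_ord hn j)) //= !mxE eqxx.
rewrite ltn_ord mulr1 big1 ?addr0 // => k kj; rewrite !mxE.
by rewrite eq_sym (negPf (kj : k != j :> nat)) mulr0.
Qed.

Lemma last_colsE p (A : 'M[R]_(p, n)) : last_cols hn A = A *m bot^T.
Proof.
apply/matrixP => i j; rewrite !mxE; set k := cast_ord _ _.
rewrite (bigD1 k) //= !mxE eqxx mulr1 big1 ?addr0 // => l lk; rewrite !mxE.
by rewrite (negPf (lk : l != (r + j)%N :> nat)) mulr0.
Qed.

End Selectors.

Notation top r n := (pid_mx r : 'M_(r, n)).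
Notation bot r n := (bot_mx _ r n).

Lemma id_blockE (R : realType) (r n q : nat) (hn : (r <= n)%N) (hq : (r <= q)%N)
    (Z : 'M[R]_(n - r, q - r)) :
  id_block hn hq Z =
  (top r n)^T *m top r q + (bot r n)^T *m Z *m bot r q.
Proof.
have -> : id_block hn hq Z = vcat hn (hcat hq 1%:M 0) (hcat hq 0 Z).
  rewrite /id_block /vcat /hcat.
  have castE n' q' k l (e : (r + k = n')%N) (f : (r + l = q')%N)
      (C : 'M[R]_(k, l)) :
      castmx (e, f) (block_mx 1%:M 0 0 C) =
      castmx (e, erefl q') (col_mx (castmx (erefl r, f) (row_mx 1%:M 0))
                                   (castmx (erefl k, f) (row_mx 0 C))).
    by case: n' / e; case: q' / f; rewrite !castmx_id.
  exact: castE.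
by rewrite vcatE !hcatE !mul0mx addr0 add0r mul1mx mulmxA.
Qed.

(** * Adapted frames *)

(** Given a row map [K] and vectors [C] with [K C = 1], the space is the direct
    sum of the columns of [C] and of the kernel of [K]; the frame [D] consists of
    [C] followed by a basis of that kernel.  An invertible [g] with [K g = top]
    supplies the kernel basis, and a shear then corrects the first columns. *)
Lemma adapted_frame (R : realType) (r n : nat) (K : 'M[R]_(r, n))
    (C : 'M[R]_(n, r)) :
  K *m C = 1%:M ->
  exists D : 'M[R]_n,
    [&& D \in unitmx, D *m (top r n)^T == C & K *m D == top r n].
Proof.
move=> KC.
have rK : \rank K = r.
  by apply/eqP; rewrite -[_ == _]/(row_free K); apply/row_freeP; exists C.
have rn : (r <= n)%N by rewrite -{1}rK rank_leq_col.
have Kf : K *m (C *m top r n) = top r n by rewrite mulmxA KC mul1mx.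
have [g ug Kg] : {g | g \in unitmx & K *m (C *m top r n) = K *m g}.
  by apply: complete_unitmx; rewrite Kf rank_pid_mx.
rewrite Kf in Kg; pose c := bot r n *m (invmx g *m C).
have tb := @top_botT R r n.
pose E : 'M[R]_n := (bot r n)^T *m c *m top r n.
have EE : E *m E = 0.
  by rewrite /E -!mulmxA (mulmxA (top r n)) tb mul0mx !mulmx0.
have uE : 1%:M + E \in unitmx.
  have: (1%:M + E) *m (1%:M - E) = 1%:M.
    by rewrite mulmxBr mulmx1 mulmxDl mul1mx EE addr0 addrK.
  by case/mulmx1_unit.
exists (g *m (1%:M + E)); apply/and3P; split.
- by rewrite unitmx_mul ug.
- rewrite -mulmxA mulmxDl mul1mx /E -(mulmxA _ (top r n)) top_topT // mulmx1.
  have gC : top r n *m (invmx g *m C) = 1%:M by rewrite Kg -mulmxA mulKVmx.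
  rewrite -[X in X + _]mulmx1 -gC.
  by rewrite /c !mulmxA -!mulmxDl topT_botT_sum mul1mx mulKVmx.
- by rewrite mulmxA -Kg mulmxDr mulmx1 /E !mulmxA tb !mul0mx addr0.
Qed.

(** * Products of the layers *)

(** Since [h] runs downwards from [H], these products cannot be computed by
    recursion on [h] as [netprod] is; the family is obtained by induction on [H]
    together with its recursion. *)
Lemma tail_products (R : realType) (d : nat -> nat) (W : params R d)
    (H r : nat) (K0 : 'M[R]_(r, d H)) :
  exists K : forall h, 'M[R]_(r, d h),
    [/\ K H = K0, forall h, (h < H)%N -> K h = K h.+1 *m W h.+1
      & forall h, (h <= H)%N -> K h *m netprod W h = K0 *m netprod W H].
Proof.
elim: H K0 => [|H IH] K0.
  exists (dfwith (T := fun h => 'M[R]_(r, d h)) (fun=> 0) K0); split=> //.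
    exact: dfwith_in.
  by move=> h; rewrite leqn0 => /eqP ->; rewrite dfwith_in.
have [K [KH Krec Kprod]] := IH (K0 *m W H.+1).
have K'E h : (h <= H)%N -> dfwith K K0 h = K h.
  by move=> hH; rewrite dfwith_out // gtn_eqF.
exists (dfwith K K0); split=> [|h|h]; first exact: dfwith_in.
  rewrite ltnS leq_eqVlt => /orP[/eqP -> | hH].
    by rewrite K'E // dfwith_in KH.
  by rewrite (K'E _ (ltnW hH)) (K'E _ hH) Krec.
rewrite leq_eqVlt => /orP[/eqP -> | hH]; first by rewrite dfwith_in.
by rewrite K'E // Kprod // mulmxA.
Qed.

Lemma rank_netprod (R : realType) (d : nat -> nat) (W : params R d) (H h : nat) :
  (h <= H)%N -> (\rank (netprod W H) <= d h)%N.
Proof.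
move=> hH; have [K [_ _ /(_ h hH)]] := @tail_products R d W H _ 1%:M.
rewrite mul1mx => <-.
by apply: leq_trans (mxrankM_maxr _ _) (rank_leq_row _).
Qed.

Lemma rmax_attained (d : nat -> nat) (H : nat) :
  exists2 h, (h <= H)%N & d h = rmax d H.
Proof.
rewrite /rmax big_nat; elim/big_ind: _ => [|x y [h hH <-] [k kH <-]|h].
- by exists 0%N.
- by rewrite /minn; case: ltnP => _; [exists h | exists k].
- by case/andP => _; exists h.
Qed.

(** * Normal form of the factorizations of a product of the layers *)

(** The last layer has the same shape as the intermediate ones once [D H] is taken
    to be the orthogonal matrix [U] of left singular vectors:
    [[U_S, U_Q Z] = U [1, 0; 0, Z]].  Layers beyond the first thus need a single
    formula. *)
Definition normal_layer (R : realType) (d : nat -> nat) (r : nat)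
    (D : forall h, 'M[R]_(d h)) (Z : forall h, 'M[R]_(d h - r, d h.-1 - r))
    (N : 'M[R]_(r, d 0%N)) (Z1 : 'M[R]_(d 1%N - r, d 0%N)) (h : nat) :
    'M[R]_(d h, d h.-1) :=
  match h with
  | 0 => 0
  | 1 => D 1%N *m ((top r (d 1%N))^T *m N + (bot r (d 1%N))^T *m Z1)
  | k.+1 => D k.+1 *m ((top r (d k.+1))^T *m top r (d k)
              + (bot r (d k.+1))^T *m Z k.+1 *m bot r (d k)) *m invmx (D k)
  end.

Lemma normal_layerE (R : realType) (d : nat -> nat) (r : nat)
    (D : forall h, 'M[R]_(d h)) (Z : forall h, 'M[R]_(d h - r, d h.-1 - r))
    (N : 'M[R]_(r, d 0%N)) (Z1 : 'M[R]_(d 1%N - r, d 0%N)) (h : nat) :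
  (2 <= h)%N ->
  normal_layer D Z N Z1 h =
  D h *m ((top r (d h))^T *m top r (d h.-1)
          + (bot r (d h))^T *m Z h *m bot r (d h.-1)) *m invmx (D h.-1).
Proof. by case: h => [|[|h]]. Qed.

(** The product of the first [h] layers is [D h [N; z]] with [z] the product
    of the blocks.  A layer of width [r] leaves no room for a block, and
    from there on the product of the blocks is zero. *)
Lemma netprod_normal (R : realType) (d : nat -> nat) (r H : nat)
    (W : params R d) (D : forall h, 'M[R]_(d h))
    (Z : forall h, 'M[R]_(d h - r, d h.-1 - r))
    (N : 'M[R]_(r, d 0%N)) (Z1 : 'M[R]_(d 1%N - r, d 0%N)) :
  (forall h, (h <= H)%N -> (r <= d h)%N) ->
  (forall h, (1 <= h < H)%N -> D h \in unitmx) ->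
  (forall h, (1 <= h <= H)%N -> W h = normal_layer D Z N Z1 h) ->
  (exists2 k, (1 <= k <= H)%N & d k = r) ->
  netprod W H = D H *m ((top r (d H))^T *m N).
Proof.
move=> rd uD WE [k /andP[k1 kH] dk].
suff step h : (1 <= h <= H)%N -> exists2 z : 'M[R]_(d h - r, d 0%N),
    netprod W h = D h *m ((top r (d h))^T *m N + (bot r (d h))^T *m z)
    & (k <= h)%N -> z = 0.
  have [|z -> ->] := step H; [by rewrite (leq_trans k1) /= | | by []].
  by rewrite mulmx0 addr0.
have empty n (z : 'M[R]_(d n - r, d 0%N)) : n = k -> z = 0.
  move=> nk; apply/matrixP => i; have := ltn_ord i.
  by rewrite {2}nk dk subnn.
elim: h => [//|[_|h IH]] hH.
  exists Z1; first by rewrite /= WE // mulmx1.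
  by move=> k1'; apply: empty; apply/eqP; rewrite eqn_leq k1.
have hlt : (h.+1 < H)%N by case/andP: hH.
have [|z netE z0] := IH; first exact: ltnW.
exists (Z h.+2 *m z); last first.
  rewrite leq_eqVlt => /orP[/eqP/esym | /z0 ->]; last by rewrite mulmx0.
  exact: empty.
have rh : (r <= d h.+1)%N by rewrite rd // ltnW.
have -> : netprod W h.+2 = W h.+2 *m netprod W h.+1 by [].
rewrite netE WE //=.
rewrite -mulmxA mulKmx ?uD // -mulmxA; congr (_ *m _).
rewrite mulmxDl !mulmxDr -!mulmxA.
rewrite !(mulmxA (top r (d h.+1))) !(mulmxA (bot r (d h.+1))).
by rewrite top_topT // bot_botT // top_botT // bot_topT // !mul0mx !mul1mx
  !mulmx0 addr0 add0r.
Qed.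

(** Let [K h] be the product of the layers above [h], read through [U_S^T], and
    [C h] the product of the layers up to [h] composed with a right inverse of
    [N].  Then [K h *m C h = 1], so [C h] is the beginning of a frame [D h]
    adapted to [K h].  As the layer [h] maps [C (h - 1)] to [C h] and pulls [K h]
    back to [K (h - 1)], it is block diagonal in these frames. *)
Lemma normal_of_netprod (R : realType) (d : nat -> nat) (r H : nat)
    (W : params R d) (U : 'M[R]_(d H)) (N : 'M[R]_(r, d 0%N)) :
  (forall h, (h <= H)%N -> (r <= d h)%N) ->
  U^T *m U = 1%:M -> row_free N ->
  netprod W H = U *m ((top r (d H))^T *m N) ->
  exists D Z Z1,
    [/\ D H = U, forall h, (1 <= h <= H)%N -> D h \in unitmx
      & forall h, (1 <= h <= H)%N -> W h = normal_layer D Z N Z1 h].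
Proof.
move=> rd UU Nfree netE.
have [K [KH Krec Kprod]] := tail_products W (top r (d H) *m U^T).
have topT := top_topT R (rd H (leqnn H)).
have KN h : (h <= H)%N -> K h *m netprod W h = N.
  move/Kprod => ->; rewrite netE -mulmxA (mulmxA U^T) UU mul1mx mulmxA.
  by rewrite topT mul1mx.
pose C h := netprod W h *m pinvmx N.
have KC h : (h <= H)%N -> K h *m C h = 1%:M.
  by move=> hH; rewrite mulmxA KN // mulmxVp.
have exD h : exists D : 'M[R]_(d h), (h <= H)%N ==>
    [&& D \in unitmx, D *m (top r (d h))^T == C h & K h *m D == top r (d h)].
  have [hH|_] := boolP (h <= H)%N; last by exists 1%:M.
  by have [D frD] := adapted_frame (KC h hH); exists D.
(* [U] itself is a frame adapted to [K H] and [C H = U_S]. *)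
pose D := dfwith (fun h => xchoose (exD h)) U.
have frD h : (h <= H)%N -> [/\ D h \in unitmx, D h *m (top r (d h))^T = C h
    & K h *m D h = top r (d h)].
  have [<- _|Hh hH] := eqVneq H h.
    rewrite /D dfwith_in; split; first by case/mulmx1_unit: UU.
      by rewrite /C netE -!mulmxA mulmxVp // mulmx1.
    by rewrite KH -mulmxA UU mulmx1.
  rewrite /D dfwith_out //.
  by have /implyP/(_ hH)/and3P[uD /eqP DT /eqP KD] := xchooseP (exD h).
have uD h hH := let: And3 u _ _ := frD h hH in u.
have DT h hH := let: And3 _ e _ := frD h hH in e.
have KD h hH := let: And3 _ _ e := frD h hH in e.
have topV h : (h <= H)%N -> top r (d h) *m invmx (D h) = K h.
  by move=> hH; rewrite -KD // mulmxK ?uD.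
pose Z h := bot r (d h) *m invmx (D h) *m W h *m D h.-1 *m (bot r (d h.-1))^T.
pose Z1 := bot r (d 1%N) *m invmx (D 1%N) *m W 1%N.
exists D, Z, Z1; split; first exact: dfwith_in.
  by move=> h /andP[_]; exact: uD.
case=> [//|[|h]] /andP[_ hH].
  apply: (canRL (mulKVmx (uD _ hH))); rewrite /Z1.
  have -> : N = top r (d 1%N) *m invmx (D 1%N) *m W 1%N.
    by rewrite topV // -{1}(KN _ hH) /= mulmx1.
  rewrite -!mulmxA (mulmxA (top r _)^T) (mulmxA (bot r _)^T) -mulmxDl.
  by rewrite topT_botT_sum mul1mx.
have hH' := ltnW hH; apply: (canRL (mulmxK (uD _ hH'))).
apply: (canRL (mulKVmx (uD _ hH))).
set M := invmx _ *m _.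
have topM : top r (d h.+2) *m M = top r (d h.+1).
  by rewrite /M !mulmxA topV // -Krec // KD.
have Mtop : M *m (top r (d h.+1))^T = (top r (d h.+2))^T.
  rewrite /M -!mulmxA DT // (mulmxA (W _)) -[_ *m pinvmx N]/(C h.+2) -DT //.
  by rewrite mulKmx ?uD.
rewrite -[LHS]mul1mx -(topT_botT_sum R r _) mulmxDl -!mulmxA topM.
congr (_ + _ *m _).
have -> : M = (top r _)^T *m top r _ + M *m ((bot r _)^T *m bot r _).
  by rewrite -Mtop -(mulmxA M) -mulmxDr topT_botT_sum mulmx1.
by rewrite mulmxDr mulmxA bot_topT // mul0mx add0r /Z /M !mulmxA.
Qed.

(** * The spectrum of [Sigma] *)

Lemma gram_svd (R : realType) (p q : nat) (S Delta : 'M[R]_(p, q))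
    (U : 'M[R]_p) (V : 'M[R]_q) :
  is_svd S U Delta V ->
  S *m S^T = U *m diag_mx (\row_i \sum_j Delta i j ^+ 2) *m U^T.
Proof.
case=> _ VV /is_diag_mxP Ddiag _ _ ->.
rewrite !trmx_mul trmxK -!mulmxA (mulmxA V^T) VV mul1mx; congr (_ *m _).
rewrite mulmxA; congr (_ *m _); apply/matrixP => i k; rewrite !mxE.
have [<- | ik] := eqVneq i k.
  by apply: eq_bigr => j _; rewrite mxE expr2.
rewrite mulr0n big1 // => j _; rewrite mxE.
have [ij | ij] := eqVneq (i : nat) j; last by rewrite Ddiag ?mul0r.
by rewrite (Ddiag k) ?mulr0 // -ij eq_sym.
Qed.

Lemma eigenvalue_orthogonal_diag (R : realType) (p : nat) (U : 'M[R]_p)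
    (lam : 'rV[R]_p) (a : R) :
  U^T *m U = 1%:M -> eigenvalue (U *m diag_mx lam *m U^T) a ->
  exists i, a = lam 0 i.
Proof.
move=> UU /eigenvalueP[v va v0].
have /eqP/rowP/= vU : v *m U *m diag_mx lam == a *: (v *m U).
  by rewrite scalemxAl -va -!mulmxA UU mulmx1.
have [i vUi] : exists i, (v *m U) 0 i != 0.
  apply/rV0Pn; apply: contraNneq v0 => vU0.
  by rewrite -[v]mulmx1 -(mulmx1C UU) mulmxA vU0 mul0mx.
exists i; have := vU i; rewrite mul_mx_diag !mxE mulrC => e.
by apply: esym; apply: (mulIf vUi); rewrite mxE.
Qed.

(** The distinct eigenvalues of [S S^T] all occur among the [p] squared singular
    values, so that none of these is repeated. *)
Lemma svd_strict (R : realType) (p q : nat) (S Delta : 'M[R]_(p, q))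
    (U : 'M[R]_p) (V : 'M[R]_q) :
  (p <= q)%N -> is_svd S U Delta V ->
  (exists s : seq R,
    [/\ uniq s, size s = p & all (eigenvalue (S *m S^T)) s]) ->
  forall i k : 'I_p, (i < k)%N ->
  \sum_j Delta k j ^+ 2 < \sum_j Delta i j ^+ 2.
Proof.
move=> pq svd [s [s_uniq s_size /allP s_eig]] i k ik.
pose lam i := \sum_j Delta i j ^+ 2.
have lam_inj : injective lam.
  apply/injectiveP/(leq_size_uniq s_uniq); last first.
    by rewrite size_map size_enum_ord s_size.
  move=> a /s_eig; rewrite (gram_svd svd).
  case/(eigenvalue_orthogonal_diag (svd_U svd)) => l ->; rewrite mxE.
  by rewrite -[\sum_j _]/(lam l) map_f // mem_enum.
have lamE l : lam l = Delta l (widen_ord pq l) ^+ 2.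
  rewrite /lam (bigD1 (widen_ord pq l)) //= big1 ?addr0 // => j jl.
  have /is_diag_mxP -> := svd_diag svd; first by rewrite expr0n.
  by rewrite eq_sym.
rewrite -![\sum_j _]/(lam _) lt_neqAle; apply/andP; split.
  by rewrite (inj_eq lam_inj) eq_sym -val_eqE /= ltn_eqF.
rewrite !lamE ler_sqr ?nnegrE ?(svd_ge0 svd) //.
by apply: (svd_decr svd) => //; exact: ltnW.
Qed.

Lemma gram_diag_gt0 (R : realType) (p q : nat) (S : 'M[R]_(p, q))
    (U : 'M[R]_p) (lam : 'rV[R]_p) :
  row_free S -> S *m S^T = U *m diag_mx lam *m U^T ->
  (forall i, 0 <= lam 0 i) -> forall i, 0 < lam 0 i.
Proof.
move=> /gram_unit uS SS lam_ge0 i; rewrite lt_neqAle lam_ge0 andbT eq_sym.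
move: uS; rewrite SS !unitmx_mul => /andP[/andP[_ uL] _].
move: uL; rewrite unitmxE unitfE det_diag => /prodf_neq0; exact.
Qed.

(** The value used to separate the [r] largest eigenvalues from the others in
    [eckart_young]. *)
Lemma separating_value (R : realType) (p r : nat) (lam : 'I_p -> R) :
  (0 < r <= p)%N -> (forall i, 0 < lam i) ->
  (forall i k : 'I_p, (i < k)%N -> lam k < lam i) ->
  exists mu, [/\ 0 <= mu, forall i : 'I_p, (i < r)%N -> mu < lam i
    & forall i : 'I_p, (r <= i)%N -> lam i < mu].
Proof.
case: r => [//|r] /= rp lam_gt0 lam_decr.
have lam_le (i k : 'I_p) : (i <= k)%N -> lam k <= lam i.
  rewrite leq_eqVlt => /orP[/eqP/val_inj -> // | /lam_decr]; exact: ltW.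
pose a := lam (Ordinal rp).
have [rp' | pr] := ltnP r.+1 p.
  pose b := lam (Ordinal rp').
  have ba : b < a by exact: lam_decr.
  have b0 : 0 < b by exact: lam_gt0.
  exists ((a + b) / 2); split=> [|i ir|i ri]; first by lra.
    by have : a <= lam i by [exact: lam_le]; lra.
  by have : lam i <= b by [exact: lam_le]; lra.
have a0 : 0 < a by exact: lam_gt0.
exists (a / 2); split=> [|i ir|i ri]; first by lra.
  by have : a <= lam i by [exact: lam_le]; lra.
by have := leq_trans (ltn_ord i) (leq_trans pr ri); rewrite ltnn.
Qed.

(** * Global minimizers *)

(** [SigmaHalf X Y] is the projection of [Y] on the row space of [X], to which
    [P *m X] belongs. *)
Lemma frob_sq_regression (R : realType) (dx dy m : nat)
    (X : 'M[R]_(dx, m)) (Y : 'M[R]_(dy, m)) (P : 'M[R]_(dy, dx)) :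
  SigmaXX X \in unitmx ->
  frob_sq (P *m X - Y) =
  frob_sq (P *m X - SigmaHalf X Y) + frob_sq (SigmaHalf X Y - Y).
Proof.
move=> uX; rewrite -frob_sq_pythagoras; first by rewrite addrA subrK.
have XS0 : X *m (SigmaHalf X Y - Y)^T = 0.
  apply: trmx_inj; rewrite trmx_mul trmxK trmx0 mulmxBl /SigmaHalf -!mulmxA.
  by rewrite -/(SigmaXX X) mulVmx // mulmx1 subrr.
by rewrite {1}/SigmaHalf -mulmxBl -mulmxA XS0 mulmx0 mxtrace0.
Qed.

Lemma row_free_SigmaYX (R : realType) (dx dy m : nat)
    (X : 'M[R]_(dx, m)) (Y : 'M[R]_(dy, m)) :
  data_assumption X Y -> row_free (SigmaYX X Y).
Proof.
move=> hd; rewrite -[row_free _]/(_ == _) -mxrank_tr /SigmaYX trmx_mul trmxK.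
by rewrite (data_XY_rank hd).
Qed.

Lemma row_free_SigmaHalf (R : realType) (dx dy m : nat)
    (X : 'M[R]_(dx, m)) (Y : 'M[R]_(dy, m)) :
  data_assumption X Y -> row_free (SigmaHalf X Y).
Proof.
move=> hd; have /row_freeP[B YB] := row_free_SigmaYX hd.
apply/row_freeP; exists (X^T *m B); rewrite /SigmaHalf !mulmxA.
by rewrite -(mulmxA _ X) -/(SigmaXX X) mulmxKV ?(data_XX_inv hd).
Qed.

(** The product of the layers has rank at most the smallest width, and [X] has
    full row rank, so that the product can be recovered from its action on [X]. *)
Lemma netprod_best (R : realType) (H : nat) (d : nat -> nat) (m : nat)
    (X : 'M[R]_(d 0%N, m)) (Y : 'M[R]_(d H, m))
    (U : 'M[R]_(d H)) (Delta : 'M[R]_(d H, m)) (V : 'M[R]_m) (W W' : params R d) :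
  let r := rmax d H in
  (0 < r)%N -> data_assumption X Y -> is_svd (SigmaHalf X Y) U Delta V ->
  netprod W' H =
    U *m pid_mx r *m U^T *m (SigmaYX X Y *m invmx (SigmaXX X)) ->
  loss X Y W' <= loss X Y W /\
  (loss X Y W <= loss X Y W' -> netprod W H = netprod W' H).
Proof.
move=> r r0 hd svd W'E; have uX := data_XX_inv hd.
have pm := leq_trans (data_dy_dx hd) (data_dx_m hd).
have rp : (r <= d H)%N by exact: rmax_le.
have SS := gram_svd svd; set lam := \row_i _ in SS.
have lamE i : lam 0 i = \sum_j Delta i j ^+ 2 by rewrite mxE.
have lam_gt0 : forall i, 0 < lam 0 i.
  apply: gram_diag_gt0 (row_free_SigmaHalf hd) SS _ => i.
  by rewrite lamE; apply: sumr_ge0 => j _; exact: sqr_ge0.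
have lam_decr (i k : 'I_(d H)) : (i < k)%N -> lam 0 k < lam 0 i.
  by rewrite !lamE; exact: (svd_strict pm svd (data_distinct hd)).
have [|mu [mu0 mu_hi mu_lo]] := separating_value _ lam_gt0 lam_decr (r := r).
  by rewrite r0.
have rk : (\rank (netprod W H *m X) <= r)%N.
  have [h hH dh] := rmax_attained d H; rewrite /r -dh.
  by apply: leq_trans (mxrankM_maxl _ _) (rank_netprod W hH).
have [] := eckart_young (svd_U svd) SS rp mu0 mu_hi mu_lo rk.
have <- : netprod W' H *m X = U *m pid_mx r *m U^T *m SigmaHalf X Y.
  by rewrite W'E -!mulmxA.
rewrite /loss (frob_sq_regression Y (netprod W H) uX).
rewrite (frob_sq_regression Y (netprod W' H) uX) !lerD2r => le_best uniq_best.
split=> //.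
move/uniq_best/(congr1 (mulmx^~ (X^T *m invmx (SigmaXX X)))) => /=.
by rewrite -!mulmxA !(mulmxA X) mulmxV // !mulmx1.
Qed.

Theorem proposition11 (R : realType) (H : nat) (hH : (2 <= H)%N)
    (d : nat -> nat) (hd : forall h : nat, (h <= H)%N -> (0 < d h)%N)
    (m : nat) (hm : (0 < m)%N)
    (X : 'M[R]_(d 0%N, m)) (Y : 'M[R]_(d H, m))
    (hdata : data_assumption X Y)
    (U : 'M[R]_(d H)) (Delta : 'M[R]_(d H, m)) (V : 'M[R]_m)
    (hsvd : is_svd (SigmaHalf X Y) U Delta V)
    (W : params R d) :
  let r := rmax d H in
  let U_S := first_cols (rmax_le d (leqnn H)) U in
  let U_Q := last_cols (rmax_le d (leqnn H)) U in
  global_minimizer X Y W <->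
  exists (D : forall h : nat, 'M[R]_(d h))
         (Z : forall h : nat, 'M[R]_(d h - r, d h.-1 - r))
         (Z1 : 'M[R]_(d 1%N - r, d 0%N)),
    (forall h : nat, (1 <= h)%N -> (h <= H.-1)%N -> D h \in unitmx) /\
    W H = hcat (rmax_le_pred d (leqnn H)) U_S (U_Q *m Z H)
            *m invmx (D H.-1) /\
    W 1%N = D 1%N
            *m vcat (rmax_le d (ltnW hH))
                 (U_S^T *m SigmaYX X Y *m invmx (SigmaXX X)) Z1 /\
    (forall (h : nat) (h2 : (2 <= h)%N) (hlt : (h < H)%N),
       W h = D h
             *m id_block (rmax_le d (ltnW hlt)) (rmax_le_pred d (ltnW hlt)) (Z h)
             *m invmx (D h.-1)).
Proof.
move=> r U_S U_Q.
pose N := U_S^T *m SigmaYX X Y *m invmx (SigmaXX X).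
have rd h : (h <= H)%N -> (r <= d h)%N by exact: rmax_le.
have [k0 k0H dk0] := rmax_attained d H.
have r0 : (0 < r)%N by rewrite /r -dk0 hd.
have UU := svd_U hsvd.
have U_SE : U_S = U *m (top r (d H))^T by exact: first_colsE.
have U_QE : U_Q = U *m (bot r (d H))^T by exact: last_colsE.
have NE : U *m ((top r (d H))^T *m N) =
    U *m pid_mx r *m U^T *m (SigmaYX X Y *m invmx (SigmaXX X)).
  by rewrite /N U_SE trmx_mul trmxK -topT_top ?rd // !mulmxA.
have Nfree : row_free N.
  have /row_freeP[B YB] := row_free_SigmaYX hdata.
  apply/row_freeP; exists (SigmaXX X *m (B *m U_S)).
  rewrite /N -3!mulmxA mulKmx ?(data_XX_inv hdata) //.
  rewrite (mulmxA (SigmaYX X Y)) YB mul1mx.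
  rewrite U_SE trmx_mul trmxK -mulmxA (mulmxA U^T) UU mul1mx top_topT //.
  exact: rd.
(* If the narrowest layer is the input, the output is as narrow. *)
have narrow : exists2 k, (1 <= k <= H)%N & d k = r.
  case: k0 k0H dk0 => [_ d0r | k kH dk]; last by exists k.+1.
  exists H; first by rewrite leqnn (ltnW hH).
  by apply/eqP; rewrite eqn_leq rd // andbT -[r]d0r (data_dy_dx hdata).
have lastE (D : forall h, 'M[R]_(d h))
    (Z : forall h, 'M[R]_(d h - r, d h.-1 - r)) Z1 :
    D H = U ->
    normal_layer D Z N Z1 H =
    hcat (rmax_le_pred d (leqnn H)) U_S (U_Q *m Z H) *m invmx (D H.-1).
  move=> DH; rewrite normal_layerE // hcatE U_SE U_QE DH mulmxDr.
  by rewrite !mulmxA.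
have midE D (Z : forall h, 'M[R]_(d h - r, d h.-1 - r)) Z1 h
    (h2 : (2 <= h)%N) (hlt : (h < H)%N) :
    normal_layer D Z N Z1 h =
    D h *m id_block (rmax_le d (ltnW hlt)) (rmax_le_pred d (ltnW hlt)) (Z h)
        *m invmx (D h.-1).
  by rewrite id_blockE normal_layerE.
have firstE D (Z : forall h, 'M[R]_(d h - r, d h.-1 - r)) Z1 :
    normal_layer D Z N Z1 1 = D 1%N *m vcat (rmax_le d (ltnW hH)) N Z1.
  by rewrite vcatE.
split=> [Wmin | [D [Z [Z1 [uD [WH [W1 Wmid]]]]]]].
  pose Wbest : params R d := normal_layer
    (dfwith (fun h => 1%:M : 'M[R]_(d h)) U) (fun=> 0) N 0.
  have bestE : netprod Wbest H = U *m ((top r (d H))^T *m N).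
    rewrite (netprod_normal rd _ (fun h _ => erefl (Wbest h)) narrow).
      by rewrite dfwith_in.
    by move=> h /andP[_ hltH]; rewrite dfwith_out ?unitmx1 // gtn_eqF.
  have [_ /(_ (Wmin _))] := netprod_best W r0 hdata hsvd (etrans bestE NE).
  rewrite bestE => WE.
  have [D [Z [Z1 [DH uD WnE]]]] := normal_of_netprod rd UU Nfree WE.
  exists D, Z, Z1; split; [|split; [|split]].
  - by move=> h h1 hH1; rewrite uD // h1 (leq_trans hH1) // leq_pred.
  - by rewrite -(lastE _ _ Z1 DH) WnE // leqnn ltnW.
  - by rewrite WnE ?firstE ?(ltnW hH).
  - by move=> h h2 hlt; rewrite WnE ?(ltnW h2) ?(ltnW hlt) //; exact: midE.
pose D' := dfwith D U.
have D'H : D' H = U by exact: dfwith_in.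
have D'E h : (h < H)%N -> D' h = D h.
  by move=> hlt; rewrite /D' dfwith_out // gtn_eqF.
have WE : netprod W H = U *m ((top r (d H))^T *m N).
  rewrite -D'H; apply: (@netprod_normal _ _ _ _ W D' Z N Z1) => //.
    move=> h /andP[h1 hltH]; rewrite D'E // uD //.
    by rewrite -ltnS prednK // (leq_trans _ hH).
  move=> h /andP[h1]; rewrite leq_eqVlt => /orP[/eqP -> | hlt].
    by rewrite WH (lastE D' Z Z1 D'H) D'E // ltn_predL ltnW.
  case: h h1 hlt => [//|[_ _|h _ hlt]]; first by rewrite firstE D'E.
  by rewrite (midE D' Z Z1 h.+2 isT hlt) (Wmid h.+2 isT hlt) !D'E // ltnW.
by move=> W'; have [] := netprod_best W' r0 hdata hsvd (etrans WE NE).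
Qed.
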